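(* There exist an infinite-dimensional real Hilbert space $\mathcal{H}$ and a non-expansive operator $T:\mathcal{H}\to\mathcal{H}$ with $0\in\overline{\mathrm{ran}(I-T)}\setminus\mathrm{ran}(I-T)$ (in particular $T$ has no fixed point) such that the sequence defined by $x^0=0$, $x^{k+1}=T(x^k)$ for $k\ge 0$, satisfies $\|x^k\|\to\infty$ and cosmically converges to $0$ weakly but not strongly; that is, as $k\to\infty$, $(1/\|x^k\|)x^k$ converges weakly to $0$ but does not converge strongly to $0$.
   Context: An operator $T:\mathcal{H}\to\mathcal{H}$ is non-expansive if $\|T(x)-T(y)\|\le\|x-y\|$ for all $x,y\in\mathcal{H}$. $I$ is the identity, $\mathrm{ran}(I-T)=\{x-T(x): x\in\mathcal{H}\}$, and the bar denotes (norm) closure. When $\|x^k\|\to\infty$, the vectors $x^k$ are non-zero for all large $k$, and $(1/\|x^k\|)x^k$ is considered for such $k$. *)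

(* Defs.v *)
From HB Require Import structures.
From mathcomp Require Import all_boot all_order all_algebra sesquilinear.
From mathcomp Require Import all_classical all_reals all_analysis.

Set Implicit Arguments.
Unset Strict Implicit.
Unset Printing Implicit Defensive.

Import Order.TTheory GRing.Theory Num.Theory.
Import numFieldNormedType.Exports.

Local Open Scope classical_set_scope.
Local Open Scope ring_scope.

(* A real Hilbert space is a complete normed module [H] together with a
   symmetric, bilinear, positive definite form [dot : {dot H for idfun}] such
   that [norm_from_dot dot]. *)
Definition norm_from_dot (R : realType) (H : normedModType R)
    (dot : {dot H for (@idfun R)}) : Prop :=
  forall x : H, dot x x = `|x| ^+ 2.

Definition infinite_dimensional (R : realType) (V : lmodType R) : Prop :=
  ~ exists (n : nat) (e : 'I_n -> V),
      forall v : V, exists c : 'I_n -> R, v = \sum_(i < n) c i *: e i.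

Definition nonexpansive (R : realType) (H : normedModType R) (T : H -> H) :
    Prop :=
  forall x y : H, `|T x - T y| <= `|x - y|.

Definition weakly_cvg (R : realType) (H : normedModType R)
    (dot : {dot H for (@idfun R)}) (u : nat -> H) (l : H) : Prop :=
  forall y : H, dot (u k) y @[k --> \oo] --> dot l y.

(* Main.v *)
Require Import Defs.
From HB Require Import structures.
From mathcomp Require Import all_boot all_order all_algebra sesquilinear.
From mathcomp Require Import all_classical all_reals all_analysis.
From mathcomp Require Import ring lra.

Set Implicit Arguments.
Unset Strict Implicit.
Unset Printing Implicit Defensive.

Import Order.TTheory GRing.Theory Num.Theory.
Import numFieldNormedType.Exports.

Local Open Scope classical_set_scope.
Local Open Scope ring_scope.

(* The space is [ell2 R], and [T] acts coordinatewise by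
   [t |-> min (t + 2^-n) 1].  A fixed point would be the constant sequence 1,
   which is not square summable, whereas the truncations of that sequence are
   moved by arbitrarily little.  The orbit of 0 is [min (k 2^-n) 1]: its
   coordinates stay in [0, 1] while its norm tends to infinity, so every
   coordinate of the normalized orbit vanishes in the limit; its terms are
   eventually unit vectors, which excludes strong convergence to 0. *)

(** * Square-summable real sequences *)

Section square_summable.
Variable R : realType.
Implicit Types f g : nat -> R.

(** A boolean predicate, so that closure under linear combinations is enough to equip [ell2] with
    its vector space structure; [f * f] is the pointwise product. *)
Definition square_summable : {pred nat -> R} :=
  mem [set f : nat -> R | cvgn (series (f * f))].

Lemma square_summableP f :
  reflect (cvgn (series (f * f))) (f \in square_summable).
Proof. by apply: (iffP idP) => [/set_mem//|/mem_set]. Qed.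

(** Partial sums of squares are nondecreasing, so one uniform bound yields both convergence and the
    same bound on the limit. *)
Lemma square_summable_ub f (M : R) :
  (forall n, \sum_(0 <= i < n) f i ^+ 2 <= M) ->
  f \in square_summable /\ limn (series (f * f)) <= M.
Proof.
move=> fM; have cf : cvgn (series (f * f)).
  apply: nondecreasing_is_cvgn.
    by apply/nondecreasing_series => i _ _; rewrite -expr2 sqr_ge0.
  by exists M => _ [n _ <-]; exact: fM.
split; first exact/square_summableP.
by apply: limr_le => //; apply: nearW => n; exact: fM.
Qed.

Lemma square_summable_le f g : (forall n, `|f n| <= `|g n|) ->
  g \in square_summable -> f \in square_summable.
Proof.
move=> fg /square_summableP cg; apply/square_summableP.
apply: (series_le_cvg _ _ _ cg) => n; rewrite /= -?expr2 ?sqr_ge0//.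
change (f n * f n <= g n * g n); rewrite -!expr2.
rewrite -(real_normK (num_real (f n))) -(real_normK (num_real (g n))).
by rewrite lerXn2r ?nnegrE.
Qed.

(** Absolute convergence by comparison, from [|f n * g n| <= f n * f n + g n * g n]. *)
Lemma is_cvg_series_mul f g : f \in square_summable -> g \in square_summable ->
  cvgn (series (f * g)).
Proof.
move=> /square_summableP cf /square_summableP cg; apply: normed_cvg.
apply: series_le_cvg (is_cvg_seriesD cf cg) => n /=.
- exact: normr_ge0.
- by rewrite addr_ge0// -expr2 sqr_ge0.
- change (`|f n * g n| <= f n * f n + g n * g n).
  rewrite ler_norml; apply/andP; split; nra.
Qed.

Lemma square_summable_submod_closed : submod_closed square_summable.
Proof.
split=> [|a f g fl gl].
  by apply: (proj1 (@square_summable_ub 0 0 _)) => n;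
    rewrite big1// => i _; exact: (expr0n _ 2).
apply/square_summableP.
have -> : (a *: f + g) * (a *: f + g) =
    a ^+ 2 *: (f * f) + ((2 * a) *: (f * g) + g * g).
  apply/funext => n.
  change ((a * f n + g n) * (a * f n + g n) =
    a ^+ 2 * (f n * f n) + ((2 * a) * (f n * g n) + g n * g n)).
  ring.
apply: is_cvg_seriesD; first by apply: is_cvg_seriesZ; exact/square_summableP.
apply: is_cvg_seriesD; last exact/square_summableP.
by apply: is_cvg_seriesZ; exact: is_cvg_series_mul.
Qed.

HB.instance Definition _ :=
  GRing.isSubmodClosed.Build R (nat -> R) square_summable
    square_summable_submod_closed.

End square_summable.

(** * The Hilbert space of square-summable sequences *)

Record ell2 (R : realType) := Ell2
  { ell2_val :> nat -> R ; ell2_valP : ell2_val \in @square_summable R }.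

Section ell2_lmodule.
Variable R : realType.

HB.instance Definition _ := [isSub for @ell2_val R].
HB.instance Definition _ := [Choice of ell2 R by <:].
HB.instance Definition _ := [SubChoice_isSubLmodule of ell2 R by <:].

Implicit Types x y z : ell2 R.

Lemma ell2P x y : x =1 y -> x = y.
Proof. by move=> xy; apply: val_inj; exact/funext. Qed.

Lemma ell2BE x y n : (x - y) n = x n - y n. Proof. by []. Qed.

Lemma ell2ZE a x n : (a *: x) n = a * x n. Proof. by []. Qed.

Lemma ell20E n : (0 : ell2 R) n = 0. Proof. by []. Qed.

Lemma ell2_sumE n (F : 'I_n -> ell2 R) j :
  (\sum_(i < n) F i) j = \sum_(i < n) F i j.
Proof. by elim/big_ind2 : _ => // _ x _ y <- <-. Qed.

Definition ell2_dot x y : R := limn (series ((x : nat -> R) * y)).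

Lemma ell2_dotC x y : ell2_dot x y = ell2_dot y x.
Proof. by rewrite /ell2_dot mulrC. Qed.

Lemma ell2_dotDZ a x y z :
  ell2_dot (a *: x + y) z = a * ell2_dot x z + ell2_dot y z.
Proof.
have cxz := is_cvg_series_mul (ell2_valP x) (ell2_valP z).
have cyz := is_cvg_series_mul (ell2_valP y) (ell2_valP z).
transitivity (limn (series (a *: ((x : nat -> R) * z) + (y : nat -> R) * z))).
  congr (limn (series _)); apply/funext => n.
  by change ((a * x n + y n) * z n = a * (x n * z n) + y n * z n); ring.
rewrite lim_seriesD ?lim_seriesZ// -lim_seriesZ//.
exact: is_cvg_seriesZ.
Qed.

Lemma ell2_dot_ge x N : \sum_(0 <= i < N) x i ^+ 2 <= ell2_dot x x.
Proof.
have cxx := is_cvg_series_mul (ell2_valP x) (ell2_valP x).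
apply: (nondecreasing_cvgn_le _ cxx).
by apply/nondecreasing_series => i _ _; rewrite -expr2 sqr_ge0.
Qed.

Lemma ell2_dot_le x M :
  (forall n, \sum_(0 <= i < n) x i ^+ 2 <= M) -> ell2_dot x x <= M.
Proof. by move=> /square_summable_ub[]. Qed.

Lemma ell2_dot_coord x n : x n ^+ 2 <= ell2_dot x x.
Proof.
apply: le_trans (ell2_dot_ge x n.+1); rewrite big_nat_recr//= lerDr.
by apply: sumr_ge0 => i _; rewrite sqr_ge0.
Qed.

Lemma ell2_dot_ge0 x : 0 <= ell2_dot x x.
Proof. by apply: le_trans (ell2_dot_coord x 0); rewrite sqr_ge0. Qed.

Lemma ell2_dot_eq0 x : ell2_dot x x = 0 -> x = 0.
Proof.
move=> x0; apply: ell2P => n; have := ell2_dot_coord x n.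
by rewrite x0 -[_ <= 0]andbT -(sqr_ge0 (x n)) -eq_le sqrf_eq0 => /eqP.
Qed.


Lemma ell2_dotDl x y z : ell2_dot (x + y) z = ell2_dot x z + ell2_dot y z.
Proof. by rewrite -[x]scale1r ell2_dotDZ mul1r scale1r. Qed.

Lemma ell2_dotZl a x z : ell2_dot (a *: x) z = a * ell2_dot x z.
Proof.
have d0 : ell2_dot 0 z = 0.
  by apply: (addrI (ell2_dot 0 z)); rewrite -ell2_dotDl !addr0.
by rewrite -[a *: x]addr0 ell2_dotDZ d0 addr0.
Qed.

Lemma ell2_dotDr x y z : ell2_dot x (y + z) = ell2_dot x y + ell2_dot x z.
Proof. by rewrite !(ell2_dotC x) ell2_dotDl. Qed.

Lemma ell2_dotZr a x y : ell2_dot x (a *: y) = a * ell2_dot x y.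
Proof. by rewrite !(ell2_dotC x) ell2_dotZl. Qed.

Lemma ell2_CauchySchwarz x y :
  ell2_dot x y ^+ 2 <= ell2_dot x x * ell2_dot y y.
Proof.
have := ell2_dot_ge0 y; rewrite le_eqVlt => /predU1P[y0|y_gt0].
  have /esym y00 := y0; rewrite y00 mulr0 (ell2_dot_eq0 y00).
  by rewrite -(scale0r (0 : ell2 R)) ell2_dotZr mul0r expr0n.
(* With [a], [b], [c] as named below, this vector has squared norm [c * (a * c - b ^+ 2)], and [c]
   is positive. *)
have := ell2_dot_ge0 (ell2_dot y y *: x + (- ell2_dot x y) *: y).
rewrite !(ell2_dotDl, ell2_dotDr, ell2_dotZl, ell2_dotZr) (ell2_dotC y x).
move: (ell2_dot x x) (ell2_dot x y) (ell2_dot y y) y_gt0 => a b c c0 h.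
by rewrite -subr_ge0 -(pmulr_rge0 _ c0); apply: le_trans h _; lra.
Qed.

Definition ell2_norm x : R := Num.sqrt (ell2_dot x x).

Lemma sqr_ell2_norm x : ell2_norm x ^+ 2 = ell2_dot x x.
Proof. by rewrite sqr_sqrtr// ell2_dot_ge0. Qed.

Lemma ell2_dot_le_norm x y : `|ell2_dot x y| <= ell2_norm x * ell2_norm y.
Proof.
rewrite -(@ler_pXn2r _ 2)// ?nnegrE ?mulr_ge0 ?sqrtr_ge0//.
by rewrite real_normK ?num_real// exprMn !sqr_ell2_norm ell2_CauchySchwarz.
Qed.

Lemma ell2_normD x y : ell2_norm (x + y) <= ell2_norm x + ell2_norm y.
Proof.
rewrite -(@ler_pXn2r _ 2)// ?nnegrE ?addr_ge0 ?sqrtr_ge0//.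
rewrite sqrrD !sqr_ell2_norm !(ell2_dotDl, ell2_dotDr) (ell2_dotC y x).
have := le_trans (ler_norm _) (ell2_dot_le_norm x y).
by rewrite mulr2n; lra.
Qed.

Lemma ell2_normZ a x : ell2_norm (a *: x) = `|a| * ell2_norm x.
Proof.
rewrite /ell2_norm ell2_dotZl ell2_dotZr mulrA -expr2.
by rewrite sqrtrM ?sqr_ge0// sqrtr_sqr.
Qed.

Lemma ell2_norm_eq0 x : ell2_norm x = 0 -> x = 0.
Proof.
by move=> x0; apply: ell2_dot_eq0; rewrite -sqr_ell2_norm x0 expr0n.
Qed.

HB.instance Definition _ :=
  Lmodule_isNormed.Build R (ell2 R) ell2_normD ell2_normZ ell2_norm_eq0.

Lemma ell2_dotE x : ell2_dot x x = `|x| ^+ 2.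
Proof. exact/esym/sqr_ell2_norm. Qed.

Lemma ell2_dot_bilinear : bilinear_for
  ( *%R : GRing.Scale.law R R ) (idfun \; *%R : GRing.Scale.law R R ) ell2_dot.
Proof.
split=> [y a x z|x a y z] /=; first exact: ell2_dotDZ.
by rewrite ell2_dotDr ell2_dotZr.
Qed.

HB.instance Definition _ := @bilinear_isBilinear.Build R (ell2 R) (ell2 R) R
  _ _ ell2_dot ell2_dot_bilinear.

Lemma ell2_dot_hermitian x y :
  ell2_dot x y = (-1) ^+ false * idfun (ell2_dot y x).
Proof. by rewrite expr0 mul1r ell2_dotC. Qed.

HB.instance Definition _ := isHermitianSesquilinear.Build R (ell2 R)
  false idfun ell2_dot ell2_dot_hermitian.

Lemma ell2_dot_gt0 x : x != 0 -> 0 < ell2_dot x x.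
Proof. by move=> x0; rewrite ell2_dotE exprn_gt0// normr_gt0. Qed.

HB.instance Definition _ := isDotProduct.Build R (ell2 R) ell2_dot ell2_dot_gt0.

Lemma ell2_norm_coord x n : `|x n| <= `|x|.
Proof.
rewrite -(@ler_pXn2r _ 2)// ?nnegrE// -ell2_dotE real_normK ?num_real//.
exact: ell2_dot_coord.
Qed.

Lemma ell2_norm_le x M : 0 <= M ->
  (forall n, \sum_(0 <= i < n) x i ^+ 2 <= M ^+ 2) -> `|x| <= M.
Proof.
move=> M0 xM; rewrite -(@ler_pXn2r _ 2)// ?nnegrE// -ell2_dotE.
exact: ell2_dot_le.
Qed.

(** Coordinates are 1-Lipschitz, so [F] converges coordinatewise to some [l]. The Cauchy bounds,
    read on partial sums, pass to the limit and show both that [l] lies in the space and that [F]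
    converges to it in norm. *)
Lemma ell2_complete (F : set_system (ell2 R)) :
  ProperFilter F -> cauchy F -> cvg F.
Proof.
move=> FF /cauchy_ballP Fc.
have cF n : cvg ((fun x : ell2 R => x n) @ F).
  apply: cauchy_cvg; apply/cauchy_ballP => e e0; have := Fc e e0.
  rewrite !near2E => -[[A B] [/= FA FB] AB].
  exists ((fun x : ell2 R => x n) @` A, (fun x : ell2 R => x n) @` B) => /=.
    by split; [apply: filterS FA|apply: filterS FB] => x Ax; exists x.
  move=> _ [[x Ax <-] [y By <-]].
  have := AB (x, y) (conj Ax By); apply: le_lt_trans.
  exact: (ell2_norm_coord (x - y)).
pose l n := lim ((fun x : ell2 R => x n) @ F).
(* [l] is not yet an element of the space, so closeness to it is expressed through partial sums. *)
have Fl e : 0 < e -> F [set x : ell2 R | forall N,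
    \sum_(0 <= i < N) (x i - l i) ^+ 2 <= e ^+ 2].
  move=> e0; have := Fc e e0; rewrite near2E => -[[A B] [/= FA FB] AB].
  apply: filterS FA => x Ax N.
  have cs : \sum_(0 <= i < N) (x i - y i) ^+ 2 @[y --> F] -->
      \sum_(0 <= i < N) (x i - l i) ^+ 2.
    apply: cvg_big => [|i _]; first exact: add_continuous.
    apply: (@cvg_comp _ _ _ _ (fun t => t ^+ 2)).
      apply: cvgB; first exact: cvg_cst.
      exact: cF.
    exact: exprn_continuous.
  (* For fixed [x] and [N] the bound holds for every [y] in [B], and a closed condition survives the
     limit of [y] along [F]. *)
  apply: (closed_cvg (fun t => t <= e ^+ 2) (@closed_le _ _) _ _ cs).
  apply: filterS FB => y By.
  have xy := ltW (AB (x, y) (conj Ax By)).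
  apply: (le_trans (ell2_dot_ge (x - y) N)).
  by rewrite ell2_dotE ler_pXn2r ?nnegrE// ltW.
(* One point [x0] at finite distance suffices: [x0 - l] is square summable, so [l] is recovered as
   the element [x0 - d]. *)
have [x0 x0l] := @filter_ex _ F _ _ (Fl 1 ltr01).
have [x0lS _] := @square_summable_ub R (fun i => x0 i - l i) _ x0l.
pose d := Ell2 x0lS; pose L := x0 - d.
have LE i : L i = l i by rewrite /L ell2BE /= opprB addrC subrK.
apply: (@cvgP _ _ L); apply/cvgrPdist_le => e e0.
apply: filterS (Fl e e0) => x xe.
rewrite distrC; apply: ell2_norm_le; first exact: ltW.
by move=> n; under eq_bigr do rewrite ell2BE LE.
Qed.

HB.instance Definition _ := Uniform_isComplete.Build (ell2 R) ell2_complete.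

End ell2_lmodule.

(** * Truncated sequences and their convergence *)

Section truncation.
Variable R : realType.
Implicit Types (f : nat -> R) (x y : ell2 R).

Definition truncate f N n : R := if (n < N)%N then f n else 0.

(** Uniform in [n], as [square_summable_ub] requires. The right side is also the sum of the
    truncated squares up to [maxn n N], from which the left side drops nonnegative terms. *)
Lemma truncate_sq_sum f N n :
  \sum_(0 <= i < n) truncate f N i ^+ 2 <= \sum_(0 <= i < N) f i ^+ 2.
Proof.
have -> : \sum_(0 <= i < N) f i ^+ 2 =
    \sum_(0 <= i < maxn n N) truncate f N i ^+ 2.
  rewrite (@big_cat_nat _ _ _ N 0 (maxn n N))//= ?leq_maxr//.
  rewrite [X in _ + X]big_nat_cond [X in _ + X]big1 ?addr0; last first.
    by move=> i /andP[/andP[Ni _] _]; rewrite /truncate ltnNge Ni expr0n.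
  by apply: eq_big_nat => i /andP[_ iN]; rewrite /truncate iN.
rewrite (@big_cat_nat _ _ _ n 0 (maxn n N))//= ?leq_maxl// lerDl.
by apply: sumr_ge0 => i _; rewrite sqr_ge0.
Qed.

Lemma truncate_square_summable f N : truncate f N \in @square_summable R.
Proof. exact: (square_summable_ub (truncate_sq_sum f N)).1. Qed.

Definition ell2_truncate f N : ell2 R := Ell2 (truncate_square_summable f N).

Lemma ell2_truncateE f N n :
  ell2_truncate f N n = if (n < N)%N then f n else 0.
Proof. by []. Qed.

(** The squared distance from [x] to its truncation is the tail of a convergent series: its limit
    minus its [N]-th partial sum. *)
Lemma ell2_truncate_cvg x : ell2_truncate x N @[N --> \oo] --> x.
Proof.
have cx := is_cvg_series_mul (ell2_valP x) (ell2_valP x).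
apply/cvgrPdist_le => e e0.
have /cvgrPdist_le/(_ _ (exprn_gt0 2 e0)) := cx.
apply: filterS => N; rewrite -/(ell2_dot x x) => dN.
apply: ell2_norm_le; first exact: ltW.
have : forall i, (x - ell2_truncate x N) i = if (i < N)%N then 0 else x i.
  by move=> i; rewrite ell2BE ell2_truncateE; case: ifP; rewrite ?subrr ?subr0.
move: (x - ell2_truncate x N) => d dE n.
apply: le_trans dN; apply: le_trans (ler_norm _).
rewrite lerBrDr; apply: le_trans (ell2_dot_ge x (maxn n N)).
rewrite [leRHS](@big_cat_nat _ _ _ N 0 (maxn n N))//= ?leq_maxr//.
rewrite [leLHS]addrC; apply: lerD; first exact: lexx.
have -> : \sum_(N <= i < maxn n N) x i ^+ 2 =
    \sum_(0 <= i < maxn n N) d i ^+ 2.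
  rewrite [RHS](@big_cat_nat _ _ _ N 0 (maxn n N))//= ?leq_maxr//.
  rewrite [X in _ = X + _]big_nat_cond [X in _ = X + _]big1 ?add0r; last first.
    move=> i /andP[/andP[_ iN] _].
    by rewrite dE iN expr0n.
  apply: eq_big_nat => i /andP[Ni _].
  by rewrite dE ltnNge Ni.
rewrite [leRHS](@big_cat_nat _ _ _ n 0 (maxn n N))//= ?leq_maxl// lerDl.
by apply: sumr_ge0 => i _; rewrite sqr_ge0.
Qed.

Lemma ell2_dot_truncate x f N :
  ell2_dot x (ell2_truncate f N) = \sum_(0 <= i < N) x i * f i.
Proof.
apply: cvg_lim => //; apply: cvg_near_cst; near=> n.
rewrite /series/= (@big_cat_nat _ _ _ N 0 n)//=; last by near: n; exists N.
rewrite [X in _ + X]big_nat_cond [X in _ + X]big1 ?addr0; last first.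
  move=> i /andP[/andP[Ni _] _].
  change (x i * truncate f N i = 0).
  by rewrite /truncate ltnNge Ni mulr0.
apply: eq_big_nat => i /andP[_ iN].
by change (x i * truncate f N i = x i * f i); rewrite /truncate iN.
Unshelve. all: by end_near. Qed.

End truncation.

(** * Infinite dimension, and weak limits of normalized sequences *)

Lemma ell2_infinite_dimensional (R : realType) :
  infinite_dimensional (ell2 R).
Proof.
move=> [n [e span]].
(* The first [n.+1] unit vectors; each already vanishes from [n.+1] on, and truncation only provides
   membership in [ell2]. *)
pose u (j : 'I_n.+1) : ell2 R := ell2_truncate (fun i => (i == j)%:R) n.+1.
have /choice[c uc] : forall j, exists c : 'I_n -> R,
    u j = \sum_(i < n) c i *: e i.
  by move=> j; exact: span.
(* A spanning family of [n] vectors would factor the identity matrix of size [n.+1] through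
   dimension [n], against the rank bound. *)
pose C := \matrix_(j < n.+1, i < n) c j i.
pose E := \matrix_(i < n, k < n.+1) e i k.
have CE : C *m E = 1%:M.
  apply/matrixP => j k; rewrite !mxE.
  transitivity (u j k).
    by rewrite uc ell2_sumE; apply: eq_bigr => i _; rewrite !mxE ell2ZE.
  by rewrite ell2_truncateE ltn_ord eq_sym.
have := leq_trans (mxrankM_maxl C E) (rank_leq_col C).
by rewrite CE mxrank1 ltnn.
Qed.

(* A fixed head of [y] contributes a bounded amount to [ell2_dot (u k) y], and
   the tail an arbitrarily small fraction of [`|u k|]. *)
Lemma ell2_weakly_cvg_normalized (R : realType) (u : nat -> ell2 R) :
  `|u k| @[k --> \oo] --> +oo ->
  (forall n, exists M, forall k, `|u k n| <= M) ->
  weakly_cvg (@ell2_dot R) (fun k => `|u k|^-1 *: u k) 0.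
Proof.
move=> uoo /choice[M uM] y.
have dot0 : ell2_dot 0 y = 0.
  by rewrite -(scale0r (0 : ell2 R)) ell2_dotZl mul0r.
change (ell2_dot (`|u k|^-1 *: u k) y @[k --> \oo] --> ell2_dot 0 y).
rewrite dot0.
apply/cvgr0Pnorm_le => e e0.
have e2 : 0 < e / 2 by rewrite divr_gt0.
have /cvgrPdist_le/(_ _ e2)/filter_ex[N yN] := @ell2_truncate_cvg R y.
pose S := \sum_(0 <= i < N) M i * `|y i|.
near=> k.
(* The term [2 * S / e] makes the head at most half of the allowed error; the 1 keeps the norm
   positive even when [S] is 0. *)
have uk : 1 + 2 * S / e <= `|u k| by near: k; move/cvgryPge : uoo; exact.
have M0 i : 0 <= M i := le_trans (normr_ge0 _) (uM i k).
have S0 : 0 <= S by apply: sumr_ge0 => i _; rewrite mulr_ge0.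
have u0 : 0 < `|u k|.
  by apply: lt_le_trans uk; rewrite ltr_pwDl// divr_ge0 ?mulr_ge0// ltW.
rewrite ell2_dotZl normrM normfV normr_id ler_pdivrMl//.
rewrite -[y in ell2_dot _ y](subrK (ell2_truncate y N)) ell2_dotDr.
apply: le_trans (ler_normD _ _) _.
have h1 : `|ell2_dot (u k) (y - ell2_truncate y N)| <= `|u k| * (e / 2).
  apply: le_trans (ell2_dot_le_norm _ _) _.
  exact: ler_wpM2l (normr_ge0 (u k)) _ _ yN.
have h2 : `|ell2_dot (u k) (ell2_truncate y N)| <= S.
  rewrite ell2_dot_truncate; apply: le_trans (ler_norm_sum _ _ _) _.
  by apply: ler_sum => i _; rewrite normrM ler_wpM2r.
have h3 : S <= `|u k| * (e / 2).
  rewrite -ler_pdivrMr//; apply: le_trans uk.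
  by rewrite invf_div mulrCA mulrA lerDr.
apply: le_trans (lerD h1 (le_trans h2 h3)) _.
by rewrite -mulrDr -splitr.
Unshelve. all: by end_near. Qed.

(** * The capped translation and its orbit of 0 *)

Section capped_translation.
Variable R : realType.

(** Steps that are positive, so that no coordinate below 1 is fixed; at most 1, so that the cap
    leaves the image of 0 intact; and square summable, so that images stay in the space. *)
Definition half_pow (n : nat) : R := 2^-1 ^+ n.

Lemma half_pow_gt0 n : 0 < half_pow n.
Proof. by rewrite exprn_gt0// invr_gt0. Qed.

Lemma half_pow_le1 n : half_pow n <= 1.
Proof. by rewrite exprn_ile1// ?invr_ge0// invf_le1// ler1n. Qed.

Lemma half_pow_square_summable : half_pow \in @square_summable R.
Proof.
apply/square_summableP.
rewrite (_ : half_pow * half_pow = geometric 1 (2^-1 ^+ 2)).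
  apply: is_cvg_geometric_series.
  by rewrite ger0_norm ?sqr_ge0// exprn_ilt1// ?invr_ge0// invf_lt1// ltr1n.
apply/funext => n; change (half_pow n * half_pow n = 1 * (2^-1 ^+ 2) ^+ n).
by rewrite mul1r -exprM mulnC exprM.
Qed.

Definition ell2_half_pow : ell2 R := Ell2 half_pow_square_summable.

Definition capped_shift (f : nat -> R) (n : nat) : R :=
  Num.min (f n + half_pow n) 1.

Lemma capped_shift_dist (f g : nat -> R) n :
  `|capped_shift f n - capped_shift g n| <= `|f n - g n|.
Proof.
rewrite /capped_shift /Num.min; move: (half_pow n) => a.
by case: ltP => ?; case: ltP => ?; rewrite !ler_norml; apply/andP; split;
  (case: (lerP 0 (f n - g n)) => ?;
    [rewrite ger0_norm//|rewrite ltr0_norm//]); lra.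
Qed.

(** The image of 0 is [half_pow] itself, so by the coordinatewise contraction the image of [x]
    differs from [half_pow] by a sequence dominated by [x]. *)
Lemma capped_shift_square_summable (x : ell2 R) :
  capped_shift x \in @square_summable R.
Proof.
rewrite -(subrK (half_pow : nat -> R) (capped_shift x)) rpredD//.
  apply: square_summable_le (ell2_valP x) => n.
  have := capped_shift_dist x (0 : ell2 R) n.
  rewrite {2}/capped_shift ell20E add0r subr0.
  by rewrite (min_idPl (half_pow_le1 n)).
exact: half_pow_square_summable.
Qed.

Definition capped_translation (x : ell2 R) : ell2 R :=
  Ell2 (capped_shift_square_summable x).

Lemma capped_translationE x n :
  capped_translation x n = Num.min (x n + half_pow n) 1.
Proof. by []. Qed.

Lemma capped_translation_nonexpansive : nonexpansive capped_translation.
Proof.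
move=> x y; apply: ell2_norm_le => // n; rewrite -ell2_dotE.
apply: le_trans (ell2_dot_ge (x - y) n); apply: ler_sum => i _.
rewrite -(real_normK (num_real (_ i))) -[leRHS](real_normK (num_real _)).
by rewrite ler_pXn2r ?nnegrE// capped_shift_dist.
Qed.

Lemma capped_translation_no_fixpoint x : capped_translation x <> x.
Proof.
move=> Tx; have x1 n : x n = 1.
  have := capped_translationE x n; rewrite Tx /Num.min.
  by case: ltP => // _; have := half_pow_gt0 n; lra.
(* The sum of this many ones exceeds [ell2_dot x x], by the choice of the Archimedean bound. *)
have := ell2_dot_ge x (Num.bound (ell2_dot x x)).
under eq_bigr do rewrite x1 expr1n.
rewrite big_const_nat iter_addr_0 subn0 => /le_lt_trans.
move=> /(_ _ (archi_boundP (ell2_dot_ge0 x))).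
by rewrite ltxx.
Qed.

Lemma capped_translation_closure :
  closure (range (fun x => x - capped_translation x)) 0.
Proof.
have h : ell2_truncate half_pow N - ell2_half_pow @[N --> \oo] --> (0 : ell2 R).
  rewrite -(subrr ell2_half_pow); apply: cvgB (cvg_cst _).
  exact: (@ell2_truncate_cvg R ell2_half_pow).
move=> B /h /(@filter_ex _ _ eventually_filter)[N BN].
(* This is the displacement of [N] ones followed by zeros: capped coordinates stay put, and each
   later one moves from 0 to [half_pow n]. *)
exists (ell2_truncate half_pow N - ell2_half_pow).
split=> //; exists (ell2_truncate (fun=> 1) N) => //.
apply: ell2P => n; rewrite !ell2BE capped_translationE !ell2_truncateE/=.
case: ifP => _.
  by rewrite min_r ?subrr// lerDl ltW// half_pow_gt0.
by rewrite !add0r min_l//; exact: half_pow_le1.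
Qed.

Definition capped_orbit k : ell2 R := iter k capped_translation 0.

(** Since the increments are positive, capping at every step amounts to capping once at the end. *)
Lemma capped_orbitE k n : capped_orbit k n = Num.min (k%:R * half_pow n) 1.
Proof.
elim: k => [|k IH]; first by rewrite mul0r min_l.
rewrite /capped_orbit iterS -/(capped_orbit k) capped_translationE IH -natr1.
have := half_pow_gt0 n; rewrite /Num.min mulrDl mul1r; move: (k%:R * _) => t a0.
by case: (ltP t 1) => // t1; do 2 case: ltP => //; lra.
Qed.

Lemma capped_orbit_bound k n : `|capped_orbit k n| <= 1.
Proof.
rewrite capped_orbitE ger0_norm ?ge_min ?lexx ?orbT//.
by rewrite le_min ler01 mulr_ge0// ltW// half_pow_gt0.
Qed.

(** Once [k] reaches [2 ^ N], the first [N] coordinates equal 1, so the squared norm is at least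
    [N], which is chosen above [A ^+ 2]. *)
Lemma capped_orbit_norm_cvgy : `|capped_orbit k| @[k --> \oo] --> +oo.
Proof.
apply/cvgryPge => A; pose N := Num.bound (A ^+ 2).
near=> k; apply: (le_trans (ler_norm A)).
rewrite -(@ler_pXn2r _ 2)// ?nnegrE// real_normK ?num_real// -ell2_dotE.
apply: le_trans (ell2_dot_ge (capped_orbit k) N).
rewrite (eq_big_nat _ _ (F2 := fun=> 1)); last first.
  move=> i /andP[_ iN]; rewrite capped_orbitE min_r ?expr1n//.
  rewrite /half_pow exprVn ler_pdivlMr ?exprn_gt0// mul1r -natrX ler_nat.
  have : (2 ^ N <= k)%N by near: k; exists (2 ^ N)%N.
  by apply: leq_trans; rewrite leq_exp2l// ltnW.
rewrite big_const_nat iter_addr_0 subn0.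
by rewrite ltW// (archi_boundP (sqr_ge0 A)).
Unshelve. all: by end_near. Qed.

End capped_translation.

Theorem mainTheorem2 (R : realType) :
  exists (H : completeNormedModType R) (dot : {dot H for (@idfun R)})
         (T : H -> H) (x : nat -> H),
    norm_from_dot dot /\
    infinite_dimensional H /\
    nonexpansive T /\
    (closure (range (fun z : H => z - T z)) `\`
       range (fun z : H => z - T z)) 0 /\
    (forall z : H, T z <> z) /\
    x 0%N = 0 /\
    (forall k : nat, x k.+1 = T (x k)) /\
    `|x k| @[k --> \oo] --> +oo /\
    weakly_cvg dot (fun k => `|x k|^-1 *: x k) 0 /\
    ~ (`|x k|^-1 *: x k @[k --> \oo] --> (0 : H)).
Proof.
exists (ell2 R), (@ell2_dot R), (@capped_translation R), (@capped_orbit R).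
split; first exact: ell2_dotE.
split; first exact: ell2_infinite_dimensional.
split; first exact: capped_translation_nonexpansive.
split.
  split; first exact: capped_translation_closure.
  move=> [z _ /eqP]; rewrite subr_eq0 => /eqP/esym.
  exact: capped_translation_no_fixpoint.
split; first exact: capped_translation_no_fixpoint.
split; first by [].
split; first by [].
have xoo := @capped_orbit_norm_cvgy R.
split; first exact: xoo.
split.
  apply: ell2_weakly_cvg_normalized => // n; exists 1 => k.
  exact: capped_orbit_bound.
move=> /cvgr0Pnorm_lt/(_ _ ltr01) xlt1.
near \oo => k.
have : `| `|capped_orbit R k|^-1 *: capped_orbit R k| < 1.
  by near: k; exact: xlt1.
(* Inverting a zero norm gives 0, as happens at [k = 0]; a norm of at least 1 ensures that the
   normalized term is a genuine unit vector. *)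
have : 1 <= `|capped_orbit R k| by near: k; move/cvgryPge : xoo; exact.
move=> x1; rewrite normrZ normfV normr_id mulVf ?ltxx//.
by rewrite gt_eqF// (lt_le_trans ltr01).
Unshelve. all: by end_near. Qed.
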